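(* Let $\mathfrak{A}$ be a Boolean subalgebra of $P(\omega)$ containing all finite subsets of $\omega$, and suppose that $K_{\mathfrak{A}}^*$ is homeomorphic to $S$, the Stone space of the measure algebra. Then $K_{\mathfrak{A}}$ is a compactification of $\omega$ that is not smooth.
   Context: Compact spaces are Hausdorff, and $C(K)$ is the Banach space of real-valued continuous functions on a compact space $K$ with the supremum norm. $\omega$ is the discrete space of natural numbers. For a compactification $\gamma\omega$ of $\omega$, the natural copy of $c_0$ in $C(\gamma\omega)$ is the closed subspace $\{f\in C(\gamma\omega): f|(\gamma\omega\setminus\omega)\equiv 0\}$. The compactification $\gamma\omega$ is called smooth if the natural copy of $c_0$ is complemented in $C(\gamma\omega)$, i.e. is the range of a bounded linear projection on $C(\gamma\omega)$. If $\mathfrak{A}\subseteq P(\omega)$ is a Boolean algebra containing all finite subsets of $\omega$, then $K_{\mathfrak{A}}$ denotes the Stone space of all ultrafilters on $\mathfrak{A}$, regarded as a compactification of $\omega$ by identifying $n\in\omega$ with the principal ultrafilter $\{A\in\mathfrak{A}: n\in A\}$; $K_{\mathfrak{A}}^*=K_{\mathfrak{A}}\setminus\omega$ is its remainder. The measure algebra is $\mathfrak{M}=Bor[0,1]/\mathcal{N}$, where $Bor[0,1]$ is the Borel $\sigma$-algebra of $[0,1]$ and $\mathcal{N}$ is the ideal of Lebesgue null sets; $S$ is the Stone space of $\mathfrak{M}$. *)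

(* Defs.v *)
From HB Require Import structures.
From mathcomp Require Import all_boot all_order all_algebra.
From mathcomp Require Import all_classical all_reals all_analysis.

Set Implicit Arguments.
Unset Strict Implicit.
Unset Printing Implicit Defensive.

Import Order.Theory GRing.Theory Num.Theory.
Import numFieldNormedType.Exports.

Local Open Scope classical_set_scope.
Local Open Scope ring_scope.

(* Boolean algebras are the [ctbDistrLatticeType]s of the order library. *)

Record set_algebra (X : Type) := SetAlgebra {
  sets_of :> set X -> Prop;
  set_algebra0 : sets_of set0;
  set_algebraC : setC_closed sets_of;
  set_algebraU : setU_closed sets_of
}.

Section set_algebra_lattice.
Context {X : Type} (A : set_algebra X).

Definition algebra_sort : Type := {a : set X | a \in mkset A}.

HB.instance Definition _ := Choice.on algebra_sort.

Definition sets_val (a : algebra_sort) : set X := sval a.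

Lemma sets_val_inj : injective sets_val.
Proof. exact: val_inj. Qed.

Lemma sets_valP (a : algebra_sort) : A (sets_val a).
Proof. exact: set_mem (svalP a). Qed.

Definition sets_sub (a : set X) (Aa : A a) : algebra_sort := exist _ a (mem_set Aa).

Lemma set_algebraI : setI_closed A.
Proof.
move=> a b Aa Ab; rewrite -[a `&` b]setCK setCI.
by apply/set_algebraC/set_algebraU; apply/set_algebraC.
Qed.

Lemma set_algebraT : A setT.
Proof. by rewrite -setC0; exact/set_algebraC/set_algebra0. Qed.

Definition alg_meet (a b : algebra_sort) : algebra_sort :=
  sets_sub (set_algebraI (sets_valP a) (sets_valP b)).
Definition alg_join (a b : algebra_sort) : algebra_sort :=
  sets_sub (set_algebraU (sets_valP a) (sets_valP b)).
Definition alg_compl (a : algebra_sort) : algebra_sort :=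
  sets_sub (set_algebraC (sets_valP a)).
Definition alg_bot : algebra_sort := sets_sub (set_algebra0 A).
Definition alg_top : algebra_sort := sets_sub set_algebraT.
Definition alg_le (a b : algebra_sort) : bool :=
  `[< sets_val a `<=` sets_val b >].

Let le_def a b : alg_le a b = (alg_meet a b == a).
Proof.
apply/asboolP/eqP => [ab|<-]; last exact: subIsetr.
by apply: sets_val_inj; exact/setIidPl.
Qed.

Let meetC : commutative alg_meet.
Proof. by move=> a b; apply: sets_val_inj; exact: setIC. Qed.
Let joinC : commutative alg_join.
Proof. by move=> a b; apply: sets_val_inj; exact: setUC. Qed.
Let meetA : associative alg_meet.
Proof. by move=> a b c; apply: sets_val_inj; exact: setIA. Qed.
Let joinA : associative alg_join.
Proof. by move=> a b c; apply: sets_val_inj; exact: setUA. Qed.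
Let joinKI (b a : algebra_sort) : alg_meet a (alg_join a b) = a.
Proof. by apply: sets_val_inj; rewrite /= setUC setKU. Qed.
Let meetKU (b a : algebra_sort) : alg_join a (alg_meet a b) = a.
Proof. by apply: sets_val_inj; rewrite /= setIC setKI. Qed.
Let meetUl : left_distributive alg_meet alg_join.
Proof. by move=> a b c; apply: sets_val_inj; exact: setIUl. Qed.
Let meetxx : idempotent_op alg_meet.
Proof. by move=> a; apply: sets_val_inj; exact: setIid. Qed.

HB.instance Definition _ :=
  @Order.isMeetJoinDistrLattice.Build set_display algebra_sort
    alg_le (fun a b => (b != a) && alg_le a b) alg_meet alg_join
    le_def (fun _ _ => erefl) meetC joinC meetA joinA joinKI meetKU
    meetUl meetxx.

Let bot_le (a : algebra_sort) : (alg_bot <= a)%O.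
Proof. by rewrite /Order.le /=; apply/asboolP => x []. Qed.

Let le_top (a : algebra_sort) : (a <= alg_top)%O.
Proof. by rewrite /Order.le /=; apply/asboolP => x. Qed.

HB.instance Definition _ := Order.hasBottom.Build set_display algebra_sort bot_le.
HB.instance Definition _ := Order.hasTop.Build set_display algebra_sort le_top.

Let joinxC (a : algebra_sort) : (a `|` alg_compl a)%O = \top%O.
Proof. by apply: sets_val_inj; exact: setUv. Qed.
Let meetxC (a : algebra_sort) : (a `&` alg_compl a)%O = \bot%O.
Proof. by apply: sets_val_inj; exact: setICr. Qed.

HB.instance Definition _ :=
  @Order.TBDistrLattice_hasComplement.Build set_display algebra_sort
    alg_compl joinxC meetxC.

End set_algebra_lattice.

Record ideal d (B : ctbDistrLatticeType d) := Ideal {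
  ideal_set :> B -> Prop;
  ideal0 : ideal_set \bot%O;
  idealU : forall a b : B, ideal_set a -> ideal_set b -> ideal_set (a `|` b)%O;
  idealS : forall a b : B, (a <= b)%O -> ideal_set b -> ideal_set a
}.

Section quotient_algebra.
Context {d : Order.disp_t} {B : ctbDistrLatticeType d} (J : ideal B).
Implicit Types a b c : B.
Local Open Scope order_scope.
Local Open Scope quotient_scope.

Definition symdiff a b : B := (a `\` b) `|` (b `\` a).

Definition eqmod_ideal a b : bool := `[< J (symdiff a b) >].

Lemma eqmod_idealP a b :
  reflect (exists2 j, J j & a `|` j = b `|` j) (eqmod_ideal a b).
Proof.
rewrite /eqmod_ideal; apply: (iffP (asboolP _)) => [Jab|[j Jj ab]].
  exists (symdiff a b) => //; rewrite /symdiff.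
  by rewrite joinA joinCA !(join_l (leBx _ _)) diffKU diffUK.
apply: idealS Jj; rewrite /symdiff leUx !leBLR.
by rewrite -ab leUl ab leUl.
Qed.

Let eqmod_refl : reflexive eqmod_ideal.
Proof. by move=> a; apply/eqmod_idealP; exists \bot => //; exact: ideal0. Qed.

Let eqmod_sym : symmetric eqmod_ideal.
Proof. by move=> a b; rewrite /eqmod_ideal /symdiff joinC. Qed.

Let eqmod_trans : transitive eqmod_ideal.
Proof.
move=> b a c /eqmod_idealP[i Ji ab] /eqmod_idealP[j Jj bc].
apply/eqmod_idealP; exists (i `|` j); first exact: idealU.
by rewrite joinA ab joinAC bc -joinA [j `|` i]joinC.
Qed.

Canonical eqmod_ideal_equiv :=
  EquivRel eqmod_ideal eqmod_refl eqmod_sym eqmod_trans.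

Definition quotient_algebra : Type := {eq_quot eqmod_ideal}.
HB.instance Definition _ := Choice.on quotient_algebra.
HB.instance Definition _ := EqQuotient.on quotient_algebra.
Implicit Types x y z : quotient_algebra.

Definition qclass a : quotient_algebra := \pi_quotient_algebra a.

Lemma qreprK x : qclass (repr x) = x.
Proof. exact: reprK. Qed.

Lemma qclass_eqP a b : reflect (qclass a = qclass b) (eqmod_ideal a b).
Proof. by rewrite -eqmodE; exact: eqP. Qed.


Definition qmeet x y : quotient_algebra := qclass (repr x `&` repr y).
Definition qjoin x y : quotient_algebra := qclass (repr x `|` repr y).
Definition qcompl x : quotient_algebra := qclass (~` repr x).
Definition qle x y : bool := qmeet x y == x.

Let eqmod_repr a : eqmod_ideal (repr (qclass a)) a.
Proof. by apply/qclass_eqP; exact: qreprK. Qed.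

Lemma pi_meet a b :
  qclass (a `&` b) = qmeet (qclass a) (qclass b).
Proof.
apply/esym/qclass_eqP.
have /eqmod_idealP[i Ji ai] := eqmod_repr a.
have /eqmod_idealP[j Jj bj] := eqmod_repr b.
apply/eqmod_idealP; exists (i `|` j); first exact: idealU.
by rewrite !joinIl ![_ `|` (i `|` j)]joinA ai ![_ `|` i `|` j]joinAC bj.
Qed.

Lemma pi_join a b :
  qclass (a `|` b) = qjoin (qclass a) (qclass b).
Proof.
apply/esym/qclass_eqP.
have /eqmod_idealP[i Ji ai] := eqmod_repr a.
have /eqmod_idealP[j Jj bj] := eqmod_repr b.
apply/eqmod_idealP; exists (i `|` j); first exact: idealU.
by rewrite joinACA ai bj joinACA.
Qed.

Lemma pi_compl a :
  qclass (~` a) = qcompl (qclass a).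
Proof.
apply/esym/qclass_eqP/asboolP.
rewrite /symdiff !diffE !complK [_ `&` a]meetC [_ `&` repr _]meetC -!diffE.
by rewrite joinC; have /asboolP := eqmod_repr a; rewrite /symdiff joinC.
Qed.

Let qmeetC : commutative qmeet.
Proof. by move=> x y; rewrite /qmeet meetC. Qed.
Let qjoinC : commutative qjoin.
Proof. by move=> x y; rewrite /qjoin joinC. Qed.
Let qmeetA : associative qmeet.
Proof.
move=> x y z; rewrite -(qreprK x) -(qreprK y) -(qreprK z).
by rewrite -!pi_meet meetA.
Qed.
Let qjoinA : associative qjoin.
Proof.
move=> x y z; rewrite -(qreprK x) -(qreprK y) -(qreprK z).
by rewrite -!pi_join joinA.
Qed.
Let qjoinKI y x : qmeet x (qjoin x y) = x.
Proof. by rewrite -(qreprK x) -(qreprK y) -pi_join -pi_meet joinKI. Qed.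
Let qmeetKU y x : qjoin x (qmeet x y) = x.
Proof. by rewrite -(qreprK x) -(qreprK y) -pi_meet -pi_join meetKU. Qed.
Let qmeetUl : left_distributive qmeet qjoin.
Proof.
move=> x y z; rewrite -(qreprK x) -(qreprK y) -(qreprK z).
by rewrite -pi_join -!pi_meet -pi_join meetUl.
Qed.
Let qmeetxx : idempotent_op qmeet.
Proof. by move=> x; rewrite -(qreprK x) -pi_meet meetxx. Qed.

HB.instance Definition _ :=
  @Order.isMeetJoinDistrLattice.Build d quotient_algebra
    qle (fun x y => (y != x) && qle x y) qmeet qjoin
    (fun _ _ => erefl) (fun _ _ => erefl) qmeetC qjoinC qmeetA qjoinA
    qjoinKI qmeetKU qmeetUl qmeetxx.

Let qbot_le x : qclass \bot <= x.
Proof. by apply/eqP; rewrite -(qreprK x) -pi_meet meet0x. Qed.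
Let qle_top x : x <= qclass \top.
Proof. by apply/eqP; rewrite -(qreprK x) -pi_meet meetx1. Qed.

HB.instance Definition _ := Order.hasBottom.Build d quotient_algebra qbot_le.
HB.instance Definition _ := Order.hasTop.Build d quotient_algebra qle_top.

Let qjoinxC x : qjoin x (qcompl x) = qclass \top.
Proof. by rewrite -(qreprK x) -pi_compl -pi_join joinxC. Qed.
Let qmeetxC x : qmeet x (qcompl x) = qclass \bot.
Proof. by rewrite -(qreprK x) -pi_compl -pi_meet meetxC. Qed.

HB.instance Definition _ :=
  @Order.TBDistrLattice_hasComplement.Build d quotient_algebra
    qcompl qjoinxC qmeetxC.

End quotient_algebra.

(* Compact spaces are Hausdorff by convention. *)
HB.mixin Record isCompactHausdorff T of Topological T := {
  compactT : compact [set: T];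
  hausdorffT : hausdorff_space T
}.

#[short(type="compactHausdorffType")]
HB.structure Definition CompactHausdorff :=
  {T of Topological T & isCompactHausdorff T}.

Definition homeomorphic (X Y : topologicalType) : Prop :=
  exists (f : X -> Y) (g : Y -> X),
    [/\ continuous f, continuous g, cancel f g & cancel g f].

Section stone_space.
Context {d : Order.disp_t} (B : ctbDistrLatticeType d).
Implicit Types (a b : B) (U : set B).

Record is_ultrafilter U : Prop := IsUltrafilter {
  ultra_top : U \top%O;
  ultra_bot : ~ U \bot%O;
  ultra_meet : forall a b, U a -> U b -> U (a `&` b)%O;
  ultra_le : forall a b, (a <= b)%O -> U a -> U b;
  ultra_compl : forall a, U a \/ U (~` a)%O
}.

Record stone := Stone { stone_filter :> B -> Prop; stoneP : is_ultrafilter stone_filter }.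

Lemma stone_inj : injective stone_filter.
Proof.
by move=> [u hu] [v hv] /= uv; subst v; congr Stone; exact: Prop_irrelevance.
Qed.

HB.instance Definition _ := gen_eqMixin stone.
HB.instance Definition _ := gen_choiceMixin stone.

Definition stone_basic a : set stone := [set x : stone | x a].

Let basic_cover : \bigcup_(O in range stone_basic) id O = [set: stone].
Proof.
rewrite -subTset => x _; exists (stone_basic \top%O); first by exists \top%O.
exact: ultra_top (stoneP x).
Qed.

Let basic_join (O P : set stone) (x : stone) :
  range stone_basic O -> range stone_basic P -> id O x -> id P x ->
  exists Q, [/\ range stone_basic Q, id Q x & id Q `<=` id O `&` id P].
Proof.
move=> [a _ <-] [b _ <-] xa xb; exists (stone_basic (a `&` b)%O); split.
- by exists (a `&` b)%O.
- exact: ultra_meet (stoneP x) _ _ xa xb.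
- move=> y yab; split.
    exact: ultra_le (stoneP y) _ _ (leIl a b) yab.
  exact: ultra_le (stoneP y) _ _ (leIr b a) yab.
Qed.

HB.instance Definition _ := isBaseTopological.Build stone basic_cover basic_join.

Lemma open_stone_basic a : open (stone_basic a).
Proof.
exists [set stone_basic a]; first by move=> _ ->; exists a.
by rewrite bigcup_set1.
Qed.

Lemma nbhs_stoneP (x : stone) (V : set stone) :
  nbhs x V <-> exists2 a, x a & stone_basic a `<=` V.
Proof.
rewrite nbhsE; split => [[W [[D sD eW] Wx] WV]|[a xa aV]].
  move: Wx WV; rewrite -eW => -[Q DQ Qx] WV.
  have [a _ aQ] : range stone_basic Q by exact: sD DQ.
  exists a; first by rewrite -aQ in Qx.
  by move=> y ya; apply: WV; exists Q => //; rewrite -aQ.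
exists (stone_basic a) => //; split => //; exact: open_stone_basic.
Qed.

Lemma stone_complN (x : stone) a : x a -> x (~` a)%O -> False.
Proof.
move=> xa xNa; apply: (ultra_bot (stoneP x)).
by rewrite -(meetxC a); exact: ultra_meet (stoneP x) _ _ xa xNa.
Qed.

Let stone_compact : compact [set: stone].
Proof.
rewrite compact_ultra => F FU _.
have FF : ProperFilter F := ultra_proper.
have uF : is_ultrafilter [set a | F (stone_basic a)].
  split => /=.
  - by apply: filterS filterT => x _; exact: ultra_top (stoneP x).
  - by move=> /filter_ex[x]; exact: ultra_bot (stoneP x).
  - move=> a b Fa Fb; apply: filterS (filterI Fa Fb) => x [].
    exact: ultra_meet (stoneP x) _ _.
  - by move=> a b ab; apply: filterS => x; exact: ultra_le (stoneP x) _ _ ab.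
  - move=> a; have [|] := in_ultra_setVsetC (stone_basic a) FU; first by left.
    move=> Fa; right; apply: filterS Fa => x /= nxa.
    by case: (ultra_compl (stoneP x) a).
exists (Stone uF); split => // V /nbhs_stoneP[a /= Fa aV].
exact: filterS Fa.
Qed.

Let stone_hausdorff : hausdorff_space stone.
Proof.
have sub (x y : stone) : cluster (nbhs x) y -> (x : set B) `<=` y.
  move=> xy a xa; case: (ultra_compl (stoneP y) a) => // yNa.
  have [||z [/= za]] := xy (stone_basic a) (stone_basic (~` a)%O).
  - by apply/nbhs_stoneP; exists a.
  - by apply/nbhs_stoneP; exists (~` a)%O.
  - by move=> zNa; exfalso; exact: stone_complN za zNa.
move=> x y xy; apply: stone_inj; rewrite eqEsubset; split; first exact: sub.
by apply: sub => V W Vx Wy; rewrite setIC; exact: xy.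
Qed.

HB.instance Definition _ := isCompactHausdorff.Build stone
  stone_compact stone_hausdorff.

End stone_space.

Section continuous_functions.
Context (R : realType) (K : compactHausdorffType).

Definition cfun : Type := continuousType K R.

HB.instance Definition _ := Choice.on cfun.

Definition is_cfun : {pred K -> R} := mem [set f : K -> R | continuous f].

Section Sub.
Context (f : K -> R) (fP : f \in is_cfun).
Let cfun_mixin := @isContinuous.Build K R f (set_mem fP).
#[local] HB.instance Definition _ := cfun_mixin.
Definition cfun_Sub : cfun := f : continuousType K R.
End Sub.

Definition cfun_val (f : cfun) : K -> R := f.
Coercion cfun_val : cfun >-> Funclass.

Let cfun_rect (P : cfun -> Type) :
  (forall f (Pf : f \in is_cfun), P (cfun_Sub Pf)) -> forall u : cfun, P u.
Proof.
move=> Psub [f [[Pf]]].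
have -> : Pf = set_mem (@mem_set _ [set f : K -> R | continuous f] f Pf).
  exact: Prop_irrelevance.
exact: Psub.
Qed.

Let cfun_valP f (Pf : f \in is_cfun) : cfun_val (cfun_Sub Pf) = f.
Proof. by []. Qed.

HB.instance Definition _ := isSub.Build _ _ cfun cfun_rect cfun_valP.

Lemma cfun_continuous (f : cfun) : continuous f.
Proof. exact: (@cts_fun _ _ (f : continuousType K R)). Qed.

Let cfun_submod : submod_closed is_cfun.
Proof.
split; first by apply: mem_set => x; exact: cst_continuous.
move=> a f g /set_mem fc /set_mem gc; apply: mem_set => x.
by apply: continuousD; [apply: continuousM; [exact: cst_continuous|exact: fc]|exact: gc].
Qed.

HB.instance Definition _ := GRing.isSubmodClosed.Build _ _ is_cfun
  (GRing.submod_closed_semi cfun_submod).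
HB.instance Definition _ := [SubChoice_isSubLmodule of cfun by <:].

Definition sup_norm (f : cfun) : R := sup [set `|f x| | x in [set: K]].

Let norm_ub (f : cfun) : has_ubound [set `|f x| | x in [set: K]].
Proof.
have /compact_bounded[M [_ fM]] : compact (f @` [set: K]).
  apply: continuous_compact; last exact: compactT.
  exact/continuous_subspaceT/cfun_continuous.
exists (M + 1) => _ [x _ <-]; apply: (fM (M + 1)); last by exists x.
by rewrite ltrDl.
Qed.

Lemma ler_sup_norm (f : cfun) (x : K) : `|f x| <= sup_norm f.
Proof. by apply: ub_le_sup; [exact: norm_ub|exists x]. Qed.

Let sup_norm_le (f : cfun) (M : R) :
  0 <= M -> (forall x, `|f x| <= M) -> sup_norm f <= M.
Proof.
move=> M0 fM; have [[y Ky]|K0] := pselect ([set: K] !=set0).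
  by apply: ge_sup; [exists `|f y|, y|move=> _ [x _ <-]; exact: fM].
suff -> : sup_norm f = 0 by [].
rewrite /sup_norm (_ : [set `|f x| | x in _] = set0) ?sup0//.
by rewrite -subset0 => y [x _ _]; apply: K0; exists x.
Qed.

Let sup_norm_ge0 (f : cfun) : 0 <= sup_norm f.
Proof.
have [[y Ky]|K0] := pselect ([set: K] !=set0).
  exact: le_trans (normr_ge0 (f y)) (ler_sup_norm f y).
rewrite /sup_norm (_ : [set `|f x| | x in _] = set0) ?sup0//.
by rewrite -subset0 => y [x _ _]; apply: K0; exists x.
Qed.

Let sup_normD (f g : cfun) : sup_norm (f + g) <= sup_norm f + sup_norm g.
Proof.
apply: sup_norm_le => [|x]; first by rewrite addr_ge0.
by apply: (le_trans (ler_normD (f x) (g x))); rewrite lerD ?ler_sup_norm.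
Qed.

Let sup_normZ_le (a : R) (f : cfun) : sup_norm (a *: f) <= `|a| * sup_norm f.
Proof.
apply: sup_norm_le => [|x]; first by rewrite mulr_ge0.
by rewrite [X in X <= _](normrM a (f x)) ler_wpM2l ?ler_sup_norm.
Qed.

Let sup_normZ (a : R) (f : cfun) : sup_norm (a *: f) = `|a| * sup_norm f.
Proof.
apply/eqP; rewrite eq_le sup_normZ_le/=; have [->|a0] := eqVneq a 0.
  by rewrite normr0 mul0r.
rewrite -ler_pdivlMl ?normr_gt0// -normfV.
by apply: le_trans (sup_normZ_le _ _); rewrite scalerA mulVf// scale1r.
Qed.

Let sup_norm_eq0 (f : cfun) : sup_norm f = 0 -> f = 0.
Proof.
move=> f0; apply/val_inj/funext => x; apply/eqP.
by rewrite -normr_le0 -f0; exact: ler_sup_norm.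
Qed.

HB.instance Definition _ := Lmodule_isNormed.Build R cfun
  sup_normD sup_normZ sup_norm_eq0.

End continuous_functions.

Definition bounded_projection (R : realType) (V : normedModType R)
    (P : {linear V -> V}) : Prop :=
  (exists M : R, forall v, `|P v| <= M * `|v|) /\ (forall v, P (P v) = P v).

Definition complemented (R : realType) (V : normedModType R) (W : set V) : Prop :=
  exists2 P : {linear V -> V}, bounded_projection P & range P = W.

Definition embedding (X Y : topologicalType) (e : X -> Y) : Prop :=
  injective e /\ forall U : set X, open U <-> exists2 V, open V & e @^-1` V = U.

(* [nat] carries its discrete topology; a compactification of it is presented
   by the map [e] that identifies it with a dense subspace of [K]. *)
Definition compactification (K : compactHausdorffType) (e : nat -> K) : Prop :=
  embedding e /\ dense (range e).

Definition remainder (K : topologicalType) (e : nat -> K) : set K := ~` range e.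

Definition natural_c0 (R : realType) (K : compactHausdorffType) (e : nat -> K) :
    set (cfun R K) :=
  [set f | forall x, remainder e x -> f x = 0].

Definition smooth (R : realType) (K : compactHausdorffType) (e : nat -> K) : Prop :=
  complemented (@natural_c0 R K e).

Section subalgebras_of_nat.
Context (A : set_algebra nat).

Definition principal (n : nat) : set (algebra_sort A) := [set a | sets_val a n].

Lemma principal_ultrafilter n : is_ultrafilter (principal n).
Proof.
split => //.
- move=> a b ab; have : alg_le a b by [].
  by move=> /asboolP; exact.
- by move=> a; have [an|nan] := pselect (sets_val a n); [left|right].
Qed.

Definition principal_point (n : nat) : stone (algebra_sort A) :=
  Stone (principal_ultrafilter n).

End subalgebras_of_nat.

Section measure_algebra.
Context (R : realType).

Definition unit_interval : Type := set_type `[0%R : R, 1%R]%classic.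
HB.instance Definition _ := Topological.on unit_interval.

(* The Borel sets of the topological space [0, 1] itself, so that complements
   are taken in [0, 1]. *)
Definition borel : set (set unit_interval) := <<s @open unit_interval >>.

Let borel_sigma : sigma_algebra setT borel.
Proof. exact: smallest_sigma_algebra. Qed.

Let borel0 : borel set0.
Proof. by case: borel_sigma. Qed.

Let borelC : setC_closed borel.
Proof. by case: borel_sigma => _ + _ => /[swap] a /[apply]; rewrite setTD. Qed.

Let borelU : setU_closed borel.
Proof.
case: borel_sigma => _ _ cup a b ba bb; rewrite -bigcup2E.
by apply: cup => -[|[|n]].
Qed.

Definition borel_algebra : set_algebra unit_interval :=
  SetAlgebra borel0 borelC borelU.

Definition null (a : algebra_sort borel_algebra) : Prop :=
  (@lebesgue_measure R).-negligible (set_val @` sets_val a).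

Let null0 : null \bot%O.
Proof. by rewrite /null image_set0; exact: negligible_set0. Qed.

Let nullU (a b : algebra_sort borel_algebra) :
  null a -> null b -> null (a `|` b)%O.
Proof. by rewrite /null image_setU; exact: negligibleU. Qed.

Let nullS (a b : algebra_sort borel_algebra) : (a <= b)%O -> null b -> null a.
Proof.
move=> ab; apply: negligibleS; apply: image_subset.
by have /asboolP : alg_le a b by [].
Qed.

Definition null_ideal : ideal (algebra_sort borel_algebra) :=
  Ideal null0 nullU nullS.

Definition measure_algebra : Type := quotient_algebra null_ideal.
HB.instance Definition _ := Order.CTBDistrLattice.on measure_algebra.

End measure_algebra.

(* Main.v *)
(** If [P] is a projection onto the natural copy of c0, the functionals
    [f |-> (f - P f) n] vanish on c0, so they live on the remainder: they are
    bounded finitely additive functions [nu_n] on the measure algebra, and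
    [nu_n E - 1_{a E}(n)] tends to 0 whenever [a E] is a subset of [nat]
    representing [E]. A bounded finitely additive function becomes absolutely
    continuous after removing a set of small measure, so all [nu_n] are absolutely
    continuous on a common set of positive measure. Since Lebesgue measure is
    atomless, [nu_n] can be steered close to 1/2; a gliding hump then yields one
    set [E] with [nu_n E] between 1/4 and 3/4 for infinitely many [n], although
    [nu_n E] must approach {0, 1}. *)

Require Import Defs.
From HB Require Import structures.
From mathcomp Require Import all_boot all_order all_algebra.
From mathcomp Require Import all_classical all_reals all_analysis.
From mathcomp Require Import measurable_realfun lra.

Set Implicit Arguments.
Unset Strict Implicit.
Unset Printing Implicit Defensive.

Import Order.Theory GRing.Theory Num.Theory.
Import numFieldNormedType.Exports.

Local Open Scope classical_set_scope.
Local Open Scope ring_scope.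

(** * Bounded finitely additive functions on a measure space *)

Section two_valued_limits.
Context d (T : measurableType d) (R : realType).
Variable mu : {measure set T -> \bar R}.
Implicit Types (nu : set T -> R) (A B E F G : set T).

Definition additive_on_measurable nu := forall A B,
  measurable A -> measurable B -> A `&` B = set0 -> nu (A `|` B) = nu A + nu B.

Definition bounded_on_measurable nu :=
  exists M, forall A, measurable A -> `|nu A| <= M.

(** Absolute continuity at a single threshold [eta]; isolating it allows countably many thresholds
    to be treated one by one. *)
Definition small_increments nu D (eta : R) := exists2 delta : R, 0 < delta &
  forall E, measurable E -> E `<=` D -> (mu E < delta%:E)%E -> `|nu E| < eta.

Definition absolutely_continuous_on nu D :=
  forall eta, 0 < eta -> small_increments nu D eta.

(** Atomlessness in the form in which it is used: a finite chain crosses the whole space in steps of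
    small measure. *)
Definition fine_chains := forall delta : R, 0 < delta ->
  exists (m : nat) (J : nat -> set T),
    [/\ forall i, measurable (J i), J 0%N = set0, J m = setT,
        forall i, J i `<=` J i.+1 & forall i, (mu (J i.+1 `\` J i) < delta%:E)%E].

Lemma additive_set0 nu : additive_on_measurable nu -> nu set0 = 0.
Proof.
move=> /(_ _ _ measurable0 measurable0 (setI0 _)); rewrite setU0 => /eqP.
by rewrite -subr_eq0 opprD addNKr oppr_eq0 => /eqP.
Qed.

Lemma additive_setD nu A B : additive_on_measurable nu ->
  measurable A -> measurable B -> A `<=` B -> nu B = nu A + nu (B `\` A).
Proof.
move=> nuD mA mB AB; rewrite -nuD ?setDIK//; last exact: measurableD.
by rewrite setDUK.
Qed.

(* Otherwise disjoint sets [E] with [eta <= nu E], of total measure below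
   [eps], could be collected until [nu] exceeds its bound. *)
Lemma upper_small_increments nu (eps eta : R) :
  additive_on_measurable nu -> bounded_on_measurable nu -> 0 < eps -> 0 < eta ->
  exists2 B, measurable B /\ (mu B < eps%:E)%E &
  exists2 delta : R, 0 < delta &
    forall E, measurable E -> E `<=` ~` B -> (mu E < delta%:E)%E -> nu E < eta.
Proof.
move=> nuD [M nuM] e0 h0; apply: contrapT => nobound.
suff H : forall k : nat, exists2 B, measurable B /\ (mu B < eps%:E)%E &
    k%:R * eta <= nu B.
  have [B [mB _]] := H (Num.truncn (M / eta)).+1.
  rewrite leNgt => /negP; apply; apply: (le_lt_trans (ler_norm _)).
  by apply: (le_lt_trans (nuM _ mB)); rewrite -ltr_pdivrMr// truncnS_gt.
elim=> [|k [B [mB Be] kB]].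
  exists set0; first by rewrite measure0 lte_fin.
  by rewrite additive_set0// mul0r.
have Bfin : mu B \is a fin_num.
  by rewrite ge0_fin_numE//; exact: lt_trans Be (ltry _).
pose delta := eps - fine (mu B).
have delta0 : 0 < delta by rewrite subr_gt0 -lte_fin fineK.
have [E [mE EB Ed nuE]] : exists E,
    [/\ measurable E, E `<=` ~` B, (mu E < delta%:E)%E & eta <= nu E].
  apply: contrapT => noE; apply: nobound; exists B => //; exists delta => // E mE EB Ed.
  by rewrite ltNge; apply/negP => nuE; apply: noE; exists E.
exists (B `|` E).
  split; first exact: measurableU.
  apply: (le_lt_trans (measureU2 _ mB mE)).
  by rewrite -[X in (X + _)%E](fineK Bfin) addeC -lteBrDr// -EFinB.
rewrite nuD//; last by apply/disjoints_subset => x Bx Ex; exact: (EB x).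
by rewrite -natr1 mulrDl mul1r lerD.
Qed.

(** The one-sided bound is applied to [nu] and to its opposite, and both exceptional sets, each of
    measure below [eps / 2], are removed. *)
Lemma exists_small_increments nu (eps eta : R) :
  additive_on_measurable nu -> bounded_on_measurable nu -> 0 < eps -> 0 < eta ->
  exists2 B, measurable B /\ (mu B <= eps%:E)%E & small_increments nu (~` B) eta.
Proof.
move=> nuD nuM e0 h0; have e20 : 0 < eps / 2 by rewrite divr_gt0.
have [B [mB Be] [r r0 rP]] := upper_small_increments nuD nuM e20 h0.
have [||C [mC Ce] [s s0 sP]] := @upper_small_increments (\- nu) _ _ _ _ e20 h0.
- by move=> E F mE mF EF /=; rewrite nuD// opprD.
- by have [M nuM'] := nuM; exists M => E mE /=; rewrite normrN nuM'.
exists (B `|` C).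
  split; first exact: measurableU.
  apply: (le_trans (measureU2 _ mB mC)).
  by rewrite (splitr eps) EFinD leeD// ltW.
exists (Num.min r s); first by rewrite lt_min r0.
rewrite setCU => E mE EBC; rewrite EFin_min lt_min => /andP[Er Es].
rewrite ltr_norml ltrNl rP// ?sP// => x /EBC[]//.
Qed.

(** Exceptional sets of measure at most [eps / 2 ^ n.+1] are merged into one. [P] is abstract
    because this is needed twice, over thresholds and over functionals. *)
Lemma small_union (P : nat -> set T -> Prop) (eps : R) :
  (forall n A B, A `<=` B -> P n A -> P n B) ->
  (forall n (e : R), 0 < e -> exists2 B, measurable B /\ (mu B <= e%:E)%E & P n B) ->
  0 < eps ->
  exists2 B, measurable B /\ (mu B <= eps%:E)%E & forall n, P n B.
Proof.
move=> PS Psmall e0.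
have e2 n : 0 < eps / (2 ^ n.+1)%:R by rewrite divr_gt0// ltr0n expn_gt0.
have /choice[B BP] n : exists B, [/\ measurable B,
    (mu B <= (eps / (2 ^ n.+1)%:R)%:E)%E & P n B].
  by have [B [mB Be] PB] := Psmall n _ (e2 n); exists B.
have mU : measurable (\bigcup_n B n).
  by apply: bigcupT_measurable => n; have [] := BP n.
exists (\bigcup_n B n); last first.
  move=> n; have [_ _] := BP n; apply: PS; exact: bigcup_sup.
split=> //; apply: (@le_trans _ _ (\sum_(n <oo) mu (B n))%E).
  by apply: measure_sigma_subadditive => // n; have [] := BP n.
apply: le_trans (epsilon_trick0 xpredT (ltW e0)).
by apply: lee_nneseries => // n _; have [] := BP n.
Qed.

(** Two nested uses of [small_union]: the inner one over the thresholds [1 / k.+1] for a fixed [n],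
    the outer one over [n]. *)
Lemma exists_absolutely_continuous_on (nu : nat -> set T -> R) (eps : R) :
  (forall n, additive_on_measurable (nu n)) ->
  (forall n, bounded_on_measurable (nu n)) -> 0 < eps ->
  exists2 B, measurable B /\ (mu B <= eps%:E)%E &
    forall n, absolutely_continuous_on (nu n) (~` B).
Proof.
move=> nuD nuM.
have mono n eta A B : A `<=` B ->
    small_increments (nu n) (~` A) eta -> small_increments (nu n) (~` B) eta.
  move=> AB [r r0 rP]; exists r => // E mE EB; apply: rP => //.
  by apply: (subset_trans EB); apply: subsetC.
apply: (@small_union (fun n A => absolutely_continuous_on (nu n) (~` A))).
  by move=> n A B AB H eta h0; exact: mono AB (H _ h0).
move=> n e e0.
have [| |B Be BP] := @small_union
   (fun k A => small_increments (nu n) (~` A) k.+1%:R^-1) e _ _ e0.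
- by move=> k A B; exact: mono.
- by move=> k e' e'0; exact: exists_small_increments.
exists B => // eta h0.
have [k kP] : exists k : nat, k.+1%:R^-1 < eta.
  exists (Num.truncn eta^-1).
  by rewrite -[ltRHS]invrK ltf_pV2 ?posrE ?invr_gt0// truncnS_gt.
have [r r0 rP] := BP k; exists r => // E mE EB Er.
exact: lt_trans (rP _ mE EB Er) kP.
Qed.

(** If every slice of [G] between consecutive members of a fine chain were null, induction along the
    chain would make [G] null. *)
Lemma exists_small_positive_subset G (delta : R) :
  fine_chains -> measurable G -> (0 < mu G)%E -> 0 < delta ->
  exists G', [/\ measurable G', G' `<=` G, (0 < mu G')%E & (mu G' < delta%:E)%E].
Proof.
move=> chains mG G0 /chains[m [J [mJ J0 Jm Jinc Jsmall]]].
apply: contrapT => noG'.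
suff H k : mu (G `&` J k) = 0%E by move: G0; rewrite -(setIT G) -Jm H ltxx.
elim: k => [|k IH]; first by rewrite J0 setI0 measure0.
have mGJ : measurable (G `&` J k) by exact: measurableI.
have mGD : measurable (G `&` (J k.+1 `\` J k)).
  by apply: measurableI => //; exact: measurableD.
apply/eqP; rewrite eq_le measure_ge0 andbT.
rewrite (_ : G `&` J k.+1 = (G `&` J k) `|` (G `&` (J k.+1 `\` J k))); last first.
  by rewrite -setIUr setDUK.
apply: (le_trans (measureU2 _ mGJ mGD)); rewrite [X in (X + _)%E]IH add0e.
rewrite leNgt; apply/negP => pos; apply: noG'.
exists (G `&` (J k.+1 `\` J k)); split => //.
apply: le_lt_trans (Jsmall k); apply: le_measure; rewrite ?inE//.
exact: measurableD.
Qed.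

(* Walking along a fine chain from [F] to [F `|` G], [nu] moves by small steps
   from about 0 to about 1, so it is close to 1/2 somewhere. *)
Lemma exists_intermediate_value nu D F G :
  fine_chains -> additive_on_measurable nu ->
  absolutely_continuous_on nu D -> measurable F -> measurable G ->
  F `&` G = set0 -> G `<=` D -> `|nu F| < 1/8 -> `|nu G - 1| < 1/8 ->
  exists F' G', [/\ [/\ measurable F', F `<=` F' & F' `<=` F `|` G],
    [/\ measurable G', G' `<=` G, F' `&` G' = set0 & (0 < mu G')%E] &
    forall E, measurable E -> F' `<=` E -> E `<=` F' `|` G' ->
      1/4 < nu E < 3/4].
Proof.
move=> chains nuD nuD_ac mF mG FG GD nuF nuG.
have h0 : 0 < 1/8 :> R by rewrite divr_gt0.
have [r r0 rP] := nuD_ac _ h0.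
have [m [J [mJ J0 Jm Jinc Jsmall]]] := chains r r0.
have mGJ k : measurable (G `&` J k) by exact: measurableI.
have FGJ k : F `&` (G `&` J k) = set0 by rewrite setIA FG set0I.
pose u k := nu (F `|` (G `&` J k)).
have uE k : u k = nu F + nu (G `&` J k) by rewrite /u nuD.
have nu0 := additive_set0 nuD.
have uS k : u k.+1 < u k + 1/8.
  rewrite !uE -addrA ltrD2l.
  rewrite (@additive_setD nu (G `&` J k) (G `&` J k.+1))//; last exact: setIS.
  rewrite ltrD2l; apply: (le_lt_trans (ler_norm _)); apply: rP.
  - exact: measurableD.
  - by move=> x [[Gx _] _]; exact: GD.
  - apply: le_lt_trans (Jsmall k); apply: le_measure; rewrite ?inE//.
    + exact: measurableD.
    + exact: measurableD.
    + by move=> x [[Gx Jx] nGJ]; split => // Jkx; exact: nGJ.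
move: nuF nuG; rewrite !ltr_norml => /andP[F1 F2] /andP[G1 G2].
(* Take the least [k] with [3/8 <= u k]. It is not 0, since [u 0 = nu F < 1/8], and one step gains
   less than 1/8, so [u k < 1/2]. *)
have [k k1 k2] : exists2 k, 3/8 <= u k & u k < 1/2.
  have um : 3/8 <= u m by rewrite uE Jm setIT; lra.
  have exu : exists k, 3/8 <= u k by exists m.
  case: (ex_minnP exu) => -[|k] k1 kmin.
    by move: k1; rewrite uE J0 setI0 nu0; lra.
  exists k.+1 => //; have := uS k.
  have : u k < 3/8 by rewrite ltNge; apply/negP => /kmin; rewrite ltnn.
  by lra.
have mF' : measurable (F `|` (G `&` J k)) by exact: measurableU.
have mGD : measurable (G `\` J k) by exact: measurableD.
(* Were the rest of [G] null, it would carry less than 1/8 of [nu], and [u k] would exceed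
   [7/8 - 1/8 - 1/8], which is above 1/2. *)
have GDpos : (0 < mu (G `\` J k))%E.
  rewrite lt0e measure_ge0 andbT; apply/eqP => GD0.
  have : `|nu (G `\` J k)| < 1/8.
    by apply: rP => //; [move=> x [/GD]|rewrite GD0 lte_fin].
  have := @additive_setD nu (G `&` J k) G nuD (mGJ k) mG (@subIsetl _ _ _).
  rewrite setDIr setDv set0U ltr_norml => e1 /andP[e2 e3].
  by move: (uE k); lra.
(* With [mu G' < r], any part of [G'] changes [nu] by less than 1/8, so values from [[3/8, 1/2[]
   stay between 1/4 and 3/4. *)
have [G' [mG' G'G G'0 G'r]] := exists_small_positive_subset chains mGD GDpos r0.
exists (F `|` (G `&` J k)), G'; split.
- by split => // x [Fx|[Gx _]]; [left|right].
- split => //; first by move=> x /G'G[].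
  apply/disjoints_subset => x [Fx|[_ Jx]] /G'G[Gx nJx]//.
  by have : (F `&` G) x by []; rewrite FG.
- move=> E mE F'E EG'.
  rewrite (additive_setD nuD mF' mE F'E).
  have mED : measurable (E `\` (F `|` (G `&` J k))) by exact: measurableD.
  have : `|nu (E `\` (F `|` (G `&` J k)))| < 1/8.
    have sG' : E `\` (F `|` (G `&` J k)) `<=` G'.
      by move=> x [/EG'[]].
    apply: rP => //; first by move=> x /sG'/G'G[/GD].
    by apply: le_lt_trans G'r; apply: le_measure; rewrite ?inE.
  by rewrite ltr_norml -/(u k) => /andP[e1 e2]; apply/andP; split; lra.
Qed.

(** Gliding hump: the bounds obtained at one stage survive all later ones, whose changes are
    confined to a reserve on which that [nu n] varies little. *)
Lemma no_two_valued_limit (nu : nat -> set T -> R) :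
  fine_chains -> (0 < mu setT)%E ->
  (forall n, additive_on_measurable (nu n)) ->
  (forall n, bounded_on_measurable (nu n)) ->
  (forall E, measurable E -> exists N, forall n, (N <= n)%N ->
     `|nu n E| < 1/8 \/ `|nu n E - 1| < 1/8) ->
  (forall F G N, measurable F -> measurable G -> F `&` G = set0 -> (0 < mu G)%E ->
     exists2 n, (N <= n)%N & `|nu n F| < 1/8 /\ `|nu n G - 1| < 1/8) ->
  False.
Proof.
move=> chains muT nuD nuM two_valued separate.
have [eps e0 epsT] : exists2 eps : R, 0 < eps & (eps%:E < mu setT)%E.
  move: muT; case: (mu setT) => [r|_|//]; last by exists 1; rewrite ?ltry.
  by rewrite lte_fin => r0; exists (r / 2); rewrite ?divr_gt0// lte_fin; lra.
have [B [mB Be] Bac] := exists_absolutely_continuous_on nuD nuM e0.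
have mD : measurable (~` B) by exact: measurableC.
(* In a pair [(F, G)], [F] is already put into the future set and [G] is the reserve where
   membership is still open; all other points are excluded for good. *)
pose S := (set T * set T)%type.
pose ok (s : S) := [/\ measurable s.1, measurable s.2, s.1 `&` s.2 = set0,
  s.2 `<=` ~` B & (0 < mu s.2)%E].
have step (N : nat) (s : S) : exists t : S, ok s ->
   [/\ ok t, s.1 `<=` t.1, t.1 `|` t.2 `<=` s.1 `|` s.2 &
     exists2 n, (N <= n)%N & forall E, measurable E -> t.1 `<=` E -> E `<=` t.1 `|` t.2 ->
        1/4 < nu n E < 3/4].
  (* Pairs that are not [ok] get a dummy successor, so that [choice] yields a total function. *)
  have [sok|nsok] := pselect (ok s); last by exists s.
  case: s sok => F G [/= mF mG FG GD G0].
  have [n nN [nF nG]] := separate F G N mF mG FG G0.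
  have [F' [G' [[mF' FF' F'FG] [mG' G'G F'G' G'0] EP]]] :=
    exists_intermediate_value chains (nuD n) (Bac n) mF mG FG GD nF nG.
  exists (F', G') => _; split => //=.
  - by split => //=; exact: subset_trans GD.
  - by rewrite subUset; split => // x /G'G; right.
  - by exists n.
have /choice[next nextP] (p : nat * S) := step p.1 p.2.
(* The stage number is passed on as the lower bound for the index [n], which makes these indices
   unbounded. *)
pose s := fix s k := if k is k'.+1 then next (k', s k') else (set0, ~` B).
have sok k : ok (s k).
  elim: k => [|k IH] /=; last by have [] := nextP (k, s k) IH.
  split => //=; first by rewrite set0I.
  rewrite lt0e measure_ge0 andbT; apply/eqP => D0; move: epsT.
  rewrite ltNge => /negP; apply; rewrite -(setUv B).
  by apply: (le_trans (measureU2 _ mB mD)); rewrite [X in (_ + X)%E]D0 adde0.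
have sS k := nextP (k, s k) (sok k).
have s1 j k : (j <= k)%N -> (s j).1 `<=` (s k).1.
  elim: k => [|k IH]; first by rewrite leqn0 => /eqP ->.
  rewrite leq_eqVlt => /orP[/eqP->//|/IH/subset_trans]; apply.
  by have [] := sS k.
have s2 j k : (j <= k)%N -> (s k).1 `|` (s k).2 `<=` (s j).1 `|` (s j).2.
  elim: k => [|k IH]; first by rewrite leqn0 => /eqP ->.
  rewrite leq_eqVlt => /orP[/eqP->//|/IH]; apply: subset_trans.
  by have [] := sS k.
(* For every [k], this set lies between [(s k).1] and the union of both components of [s k]. *)
pose E := \bigcup_k (s k).1.
have mE : measurable E by apply: bigcupT_measurable => k; have [] := sok k.
have [N NP] := two_valued E mE.
have [_ _ _ [n Nn nP]] := sS N.
have : 1/4 < nu n E < 3/4.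
  apply: nP => //; first exact: (@bigcup_sup _ _ N.+1 _ (fun k => (s k).1)).
  move=> x [k _ skx]; have [kN|/ltnW Nk] := leqP k N.+1.
    by left; exact: s1 kN _ skx.
  by apply: s2 Nk _ _; left.
by case: (NP n Nn); rewrite ltr_norml => /andP[] + + /andP[];
  clear; lra.
Qed.

End two_valued_limits.

(** * Clopen sets in Stone spaces *)

Lemma stone_basic_join d (B : ctbDistrLatticeType d) (a b : B) :
  stone_basic (a `|` b)%O = stone_basic a `|` stone_basic b.
Proof.
apply/seteqP; split => x /=; last first.
  case; apply: ultra_le (stoneP x) _ _ _; [exact: leUl|exact: leUr].
move=> xab; case: (ultra_compl (stoneP x) a) => [|xNa]; first by left.
right; apply: ultra_le (stoneP x) _ _ _ (ultra_meet (stoneP x) xab xNa).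
by rewrite meetUl meetxC join0x leIl.
Qed.

(** Compactness: if no basic set inside [V] on [C] covers the trace of [V], the uncovered parts form
    a filter base. A cluster point lies in [C], outside [W], hence in [V], and a basic neighbourhood
    of it inside [V] gives a contradiction. *)
Lemma clopen_trace_stone_basic d (B : ctbDistrLatticeType d) (C V W : set (stone B)) :
  closed C -> open V -> open W -> C `<=` V `|` W -> C `&` V `&` W = set0 ->
  exists a, C `&` stone_basic a = C `&` V.
Proof.
move=> cC oV oW CVW VW0.
pose I := [set a : B | C `&` stone_basic a `<=` V].
suff [a aI Va] : exists2 a, I a & C `&` V `<=` stone_basic a.
  exists a; apply/seteqP; split => x [Cx xP]; split => //; first exact: aI.
  by apply: Va.
apply: contrapT => noa.
pose F := filter_from I (fun a => (C `&` V) `\` stone_basic a).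
have FF : ProperFilter F.
  apply: filter_from_proper.
    apply: filter_from_filter.
      by exists \bot%O => x [_ /(ultra_bot (stoneP x))].
    move=> a b aI bI; exists (a `|` b)%O.
      by rewrite /I /= stone_basic_join setIUr subUset.
    move=> x [CVx]; rewrite stone_basic_join => nab.
    by split; split => // h; apply: nab; [left|right].
  move=> a aI; apply: contrapT => /set0P/negP/negPn/eqP e; apply: noa.
  by exists a => //; rewrite -setD_eq0.
have /(_ F FF) [|x [_ cx]] := @compactT (stone B); first exact: filterT.
have Cx : C x.
  apply: cC => U Ux.
  have [|y [[[Cy _] _] Uy]] := cx (C `&` V `\` stone_basic \bot%O) U _ Ux.
    by exists \bot%O => // z [_ /(ultra_bot (stoneP z))].
  by exists y.
have nWx : ~ W x.
  move=> Wx.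
  have [||y [[[Cy Vy] _] Wy]] := cx (C `&` V `\` stone_basic \bot%O) W.
  - by exists \bot%O => // z [_ /(ultra_bot (stoneP z))].
  - exact: open_nbhs_nbhs.
  - by have : (C `&` V `&` W) y by []; rewrite VW0.
have Vx : V x by have [] := CVW x Cx.
have /nbhs_stoneP[a xa aV] : nbhs x V by exact: open_nbhs_nbhs.
have [||y [[_ nya] ya]] := cx (C `&` V `\` stone_basic a) (stone_basic a) => //.
- by exists a => // z [_ /aV].
- by apply: open_nbhs_nbhs; split => //; exact: open_stone_basic.
Qed.

(** * The compactification of the natural numbers and its remainder *)

Section algebra_of_subsets_of_nat.
Variable A : set_algebra nat.
Hypothesis A_finite : forall F : set nat, finite_set F -> A F.
Local Notation K := (stone (algebra_sort A)).
Local Notation e := (principal_point A).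

Definition atom (n : nat) : algebra_sort A := sets_sub (A_finite (finite_set1 n)).

Lemma alg_leP (a b : algebra_sort A) :
  reflect (sets_val a `<=` sets_val b) (a <= b)%O.
Proof. exact: asboolP. Qed.

Lemma stone_nonempty (x : K) a : x a -> sets_val a !=set0.
Proof.
move=> xa; apply/set0P; apply/eqP => a0; apply: (ultra_bot (stoneP x)).
by rewrite (_ : \bot%O = a)//; apply: sets_val_inj; rewrite a0.
Qed.

(** Every member of an ultrafilter containing the singleton of [n] meets that singleton, so the
    ultrafilter is principal. Thus the points of [nat] are isolated. *)
Lemma stone_basic_atom n : stone_basic (atom n) = [set e n].
Proof.
apply/seteqP; split => [x xn|_ ->//]; apply: stone_inj.
have sub (y : K) a : y (atom n) -> y a -> sets_val a n.
  move=> yn ya; have := ultra_meet (stoneP y) yn ya.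
  by move=> /stone_nonempty[m /= [->]].
apply/seteqP; split => a xa; first exact: sub xa.
by apply: ultra_le (stoneP x) _ _ _ xn; apply/alg_leP => m ->.
Qed.

Lemma open_principal (U : set nat) : open (e @` U).
Proof.
rewrite (_ : _ @` _ = \bigcup_(n in U) stone_basic (atom n)).
  by apply: bigcup_open => n _; exact: open_stone_basic.
apply/seteqP; split.
  by move=> _ [n Un <-]; exists n => //; rewrite stone_basic_atom.
by move=> x [n Un]; rewrite stone_basic_atom => ->; exists n.
Qed.

Lemma principal_point_inj : injective e.
Proof.
move=> m n mn; have : stone_basic (atom n) (e m) by rewrite mn stone_basic_atom.
by [].
Qed.

Lemma compactification_principal_point : compactification e.
Proof.
split; last first.
  move=> O [x Ox] oO; have /nbhs_stoneP[a xa aO] : nbhs x O by exact: open_nbhs_nbhs.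
  have [n an] := stone_nonempty xa.
  by exists (e n); split; [exact: aO|exists n].
split; first exact: principal_point_inj.
move=> U; split => [_|_]; last exact: discrete_open.
exists (e @` U); first exact: open_principal.
apply/seteqP; split => [n [m Um /principal_point_inj<-//]|n Un]; by exists n.
Qed.

Lemma closed_remainder : closed (remainder e).
Proof. by rewrite /remainder closedC; exact: open_principal. Qed.

(** A nonprincipal ultrafilter contains the complement of each singleton, so 0, 1, ... can be
    removed from [a] one at a time. *)
Lemma remainder_infinite (x : K) a N : remainder e x -> x a ->
  exists2 n, (N <= n)%N & sets_val a n.
Proof.
move=> rx; elim: N a => [|N IH] a xa.
  by have [n an] := stone_nonempty xa; exists n.
have xN : x (~` atom N)%O.
  case: (ultra_compl (stoneP x) (atom N)) => // xN; exfalso; apply: rx.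
  have : stone_basic (atom N) x by [].
  by rewrite stone_basic_atom => ->; exists N.
have [n Nn [/= an nN]] := IH _ (ultra_meet (stoneP x) xa xN).
by exists n => //; rewrite ltn_neqAle Nn andbT; apply/eqP => /esym.
Qed.

(** * Continuous functions and the functionals given by a projection *)

Section real_functions.
Variable R : realType.

(** Otherwise points [e n] with [n] arbitrarily large and [eps <= |f (e n)|] cluster somewhere. As
    each [e n] is isolated, the cluster point is in the remainder, where [f] vanishes, against
    continuity. *)
Lemma natural_c0_small (f : cfun R K) (eps : R) : natural_c0 e f -> 0 < eps ->
  exists N, forall n, (N <= n)%N -> `|f (e n)| < eps.
Proof.
move=> f0 eps0; apply: contrapT => noN.
pose S N : set K := [set e n | n in [set n | (N <= n)%N /\ eps <= `|f (e n)|]].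
pose F := filter_from [set: nat] S.
have FF : ProperFilter F.
  apply: filter_from_proper.
    apply: filter_from_filter; first by exists 0%N.
    move=> i j _ _; exists (maxn i j) => // _ [n [+ fn] <-]; rewrite geq_max.
    by move=> /andP[? ?]; split; exists n.
  move=> N _; apply: contrapT => NF; apply: noN; exists N => n Nn.
  by rewrite ltNge; apply/negP => fn; apply: NF; exists (e n), n.
have /(_ F FF) [|x [_ cx]] := @compactT K; first exact: filterT.
have rx : remainder e x.
  move=> [k _ kx].
  have [||_ [[n [kn _] <-]]] := cx (S k.+1) (stone_basic (atom k)).
  - by exists k.+1.
  - by rewrite -kx; apply: open_nbhs_nbhs; split => //; exact: open_stone_basic.
  - by rewrite stone_basic_atom => /principal_point_inj nk; move: kn; rewrite nk /= ltnn.
have fx : \forall y \near x, `|f y| < eps.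
  have /cvgrPdist_lt/(_ _ eps0) := @cfun_continuous R K f x.
  by apply: filterS => y; rewrite f0// sub0r normrN.
have [|_ [[n [_ fn] <-] /=]] := cx (S 0%N) _ _ fx.
  by exists 0%N.
by rewrite ltNge fn.
Qed.

Definition stone_indic (a : algebra_sort A) : K -> R := \1_(stone_basic a).

Lemma stone_indic_continuous a : stone_indic a \in @is_cfun R K.
Proof.
apply: mem_set => x.
have [xa|xa] := ultra_compl (stoneP x) a.
  apply: (@near_cst_continuous K R 1); apply/nbhs_stoneP; exists a => // y ya.
  by rewrite /stone_indic indicE mem_set.
apply: (@near_cst_continuous K R 0); apply/nbhs_stoneP; exists (~` a)%O => // y ya.
by rewrite /stone_indic indicE memNset// => ya'; exact: stone_complN ya' ya.
Qed.

Definition cindic a : cfun R K := cfun_Sub (stone_indic_continuous a).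

Lemma cindicE a x : (cindic a : K -> R) x = (`[< x a >])%:R.
Proof. by rewrite [LHS]indicE. Qed.


(* With [P] the projection, [nu n a] is the value of [f - P f] at [n] for [f] the
   indicator function of [a]: since [id - P] kills the natural copy of c0, it
   depends only on the trace of [a] on the remainder. *)
Lemma smooth_functionals : smooth R e ->
  exists nu : nat -> algebra_sort A -> R,
  [/\ forall n a b c,
        (forall x, remainder e x -> ~ (x b /\ x c) /\ (x a <-> x b \/ x c)) ->
        nu n a = nu n b + nu n c,
      forall n, exists M, forall a, `|nu n a| <= M
    & forall a eps, 0 < eps -> exists N, forall n, (N <= n)%N ->
        `|nu n a - \1_(sets_val a) n| < eps].
Proof.
move=> [P [[M PM] PP] Pc0].
have Pid f : natural_c0 e f -> P f = f by rewrite -Pc0 => -[g _ <-].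
have inc0 f : natural_c0 e (P f) by rewrite -Pc0; exists f.
exists (fun n a => (cindic a : K -> R) (e n) - (P (cindic a) : K -> R) (e n)).
split.
- move=> n a b c abc.
  have /Pid : natural_c0 e (cindic a - (cindic b + cindic c)).
    move=> x /abc[nbc [h1 h2]]; apply/eqP; rewrite subr_eq0; apply/eqP.
    rewrite -[LHS]/((cindic a : K -> R) x).
    rewrite -[RHS]/((cindic b : K -> R) x + (cindic c : K -> R) x) !cindicE.
    have [xb|xb] := pselect (x b); have [xc|xc] := pselect (x c).
    + by exfalso; exact: nbc.
    + by rewrite (asboolT xb) (asboolF xc) asboolT ?addr0//; apply: h2; left.
    + by rewrite (asboolF xb) (asboolT xc) asboolT ?add0r//; apply: h2; right.
    + by rewrite (asboolF xb) (asboolF xc) asboolF ?addr0// => /h1[].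
  rewrite linearB linearD => /(congr1 (fun f : cfun R K => (f : K -> R) (e n))) /=.
  set Pa := P (cindic a); set Pb := P (cindic b); set Pc := P (cindic c).
  move=> h.
  have {}h : (Pa : K -> R) (e n) - ((Pb : K -> R) (e n) + (Pc : K -> R) (e n)) =
     (cindic a : K -> R) (e n) - ((cindic b : K -> R) (e n) + (cindic c : K -> R) (e n)).
    exact: h.
  by move: h; clear; lra.
- move=> n; exists (1 + `|M|) => a.
  have c1 x : `|(cindic a : K -> R) x| <= 1.
    by rewrite cindicE ger0_norm// lern1 leq_b1.
  apply: (le_trans (ler_normB _ _)); apply: lerD => //.
  apply: (le_trans (ler_sup_norm _ _)); apply: (le_trans (PM _)).
  have n1 : `|cindic a| <= 1.
    by apply: ge_sup; [exists `|(cindic a : K -> R) (e n)|, (e n)|move=> _ [x _ <-]].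
  rewrite (le_trans (ler_wpM2r _ (ler_norm M)))//.
  by rewrite -[leRHS]mulr1 ler_wpM2l.
(* The difference is the value at [n] of [- P f], with [f] the indicator, and [P f] lies in the copy
   of c0. *)
- move=> a eps eps0; have [N NP] := natural_c0_small (inc0 (cindic a)) eps0.
  exists N => n /NP; rewrite -normrN; congr (`|_| < _).
  have -> : (cindic a : K -> R) (e n) = \1_(sets_val a) n.
    by rewrite cindicE indicE.
  by rewrite addrAC subrr add0r.
Qed.

End real_functions.
End algebra_of_subsets_of_nat.

(** * Representatives of clopen sets and ultrafilters on quotients *)

(** The preimages of [b] and of its complement split [C] into two relatively clopen parts, and
    [clopen_trace_stone_basic] applies. This lifts classes of the measure algebra to subsets of
    [nat]. *)
Lemma continuous_stone_representative d d' (B : ctbDistrLatticeType d)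
    (B' : ctbDistrLatticeType d') (C : set (stone B)) (f : set_type C -> stone B') b :
  closed C -> continuous f -> exists a, forall x, (set_val x : stone B) a <-> f x b.
Proof.
move=> cC /continuousP cf.
have [V oV Vb] := cf _ (open_stone_basic b).
have [W oW Wb] := cf _ (open_stone_basic (~` b)%O).
have Ve x : V (set_val x) <-> f x b by rewrite -[V _]/((set_val @^-1` V) x) Vb.
have We x : W (set_val x) <-> f x (~` b)%O by rewrite -[W _]/((set_val @^-1` W) x) Wb.
have [||a aP] := clopen_trace_stone_basic cC oV oW.
- move=> x Cx; have [/(Ve (SigSub (mem_set Cx)))|/(We (SigSub (mem_set Cx)))] :=
    ultra_compl (stoneP (f (SigSub (mem_set Cx)))) b; by [left|right].
- apply/seteqP; split => // x [[Cx Vx] Wx].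
  apply: (@stone_complN _ _ (f (SigSub (mem_set Cx))) b); first exact/Ve.
  exact/We.
exists a => x; rewrite -Ve; have Cx : C (set_val x) by exact: set_mem (valP x).
split => [xa|Vx].
  by have [] : (C `&` V) (set_val x) by rewrite -aP.
by have [] : (C `&` stone_basic a) (set_val x) by rewrite aP.
Qed.

(** The differences of [a] and members of [J] generate a proper filter. An ultrafilter of subsets of
    [X] refining it contains the complement of each member of [J], so it respects congruence and
    descends to the quotient. *)
Lemma exists_ultrafilter_quotient (X : Type) (A : set_algebra X)
    (J : ideal (algebra_sort A)) (a : algebra_sort A) :
  ~ J a -> exists s : stone (quotient_algebra J), s (qclass J a).
Proof.
move=> nJa.
pose F := filter_from J (fun j => sets_val a `\` sets_val j).
have FF : ProperFilter F.
  apply: filter_from_proper.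
    apply: filter_from_filter; first by exists \bot%O; exact: ideal0.
    move=> i j Ji Jj; exists (i `|` j)%O; first exact: idealU.
    by move=> x [ax nij]; split; split => // h; apply: nij; [left|right].
  move=> j Jj; apply: contrapT => aj; apply: nJa; apply: idealS Jj.
  apply/asboolP => x ax; apply: contrapT => jx; apply: aj.
  by exists x.
have [G [GU FG]] := ultraFilterLemma FF.
have GF : ProperFilter G := ultra_proper.
pose g (b : algebra_sort A) := G (sets_val b).
have gS b c : sets_val b `<=` sets_val c -> g b -> g c by move=> bc; exact: filterS.
have gmod b c : qclass J b = qclass J c -> g b -> g c.
  move=> /qclass_eqP/eqmod_idealP[j Jj bc] gb.
  have gj : G (~` sets_val j).
    by apply: FG; exists j => // x [].
  apply: filterS (filterI gb gj) => x [bx njx].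
  have : sets_val (b `|` j)%O x by left.
  by rewrite bc => -[].
have us : is_ultrafilter [set q : quotient_algebra J | g (repr q)].
  split => /=.
  - apply: (gmod \top%O); first by rewrite qreprK.
    exact: filterT.
  - move=> /(gmod _ \bot%O); rewrite qreprK => /(_ erefl).
    exact: filter_not_empty.
  - move=> b c gb gc; apply: (gmod (repr b `&` repr c)%O); last exact: filterI.
    by rewrite qreprK.
  - move=> b c; rewrite leEmeet => /eqP <- h.
    apply: (gS (repr b `&` repr c)%O); first by move=> x [].
    by apply: gmod h; rewrite qreprK.
  - move=> b; have [|] := in_ultra_setVsetC (sets_val (repr b)) GU; first by left.
    move=> h; right; apply: (gmod (~` repr b)%O) => //.
    by rewrite qreprK.
exists (Stone us) => /=; apply: (gmod a); first by rewrite qreprK.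
by apply: FG; exists \bot%O; [exact: ideal0|move=> x []].
Qed.

(** * Borel classes and Lebesgue measure on the unit interval *)

Section unit_interval_classes.
Variable R : realType.
Local Notation T := (measurableTypeR R).
Local Notation mu := (@lebesgue_measure R).
Local Notation itv01 := ((`[0 : R, 1]%classic : set R) : set T).

Let inclusion : unit_interval R -> R := set_val.

(** The sets with Borel trace form a sigma-algebra, so open intervals suffice. This links the
    measurable sets of the line to the Borel sets of the subspace [0, 1]. *)
Lemma borel_preimage (Y : set T) : measurable Y -> borel (inclusion @^-1` Y).
Proof.
have [b0 bC bU] : sigma_algebra setT (@borel R) by exact: smallest_sigma_algebra.
rewrite -[measurable Y]/((@ocitv R).-sigma.-measurable Y) RGenOpens.measurableE.
apply: (smallest_sub (X := [set Z : set R | borel (inclusion @^-1` Z)])).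
  split => /=.
  - by rewrite preimage_set0.
  - by move=> Z /bC; rewrite !setTD preimage_setC.
  - by move=> Z bZ; rewrite preimage_bigcup; exact: bU.
move=> _ [x [y ->]] /=; apply: sub_sigma_algebra.
apply: open_comp; last exact: interval_open.
by move=> z _; exact: initial_continuous.
Qed.

(** The intended [c Y] is the class of the trace of [Y] on [0, 1]; the existential form hides the
    Borel proofs on which this class depends. *)
Lemma exists_preimage_class : exists c : set T -> measure_algebra R,
  [/\ forall Y Z, measurable Y -> measurable Z -> c (Y `|` Z) = (c Y `|` c Z)%O,
      forall Y Z, measurable Y -> measurable Z -> Y `&` Z = set0 ->
        (c Y `&` c Z)%O = \bot%O
    & forall Y, measurable Y -> (0 < mu (Y `&` itv01))%E ->
        exists s : stone (measure_algebra R), s (c Y)].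
Proof.
pose cls (Y : set T) (bY : borel (inclusion @^-1` Y)) : measure_algebra R :=
  qclass (null_ideal R) (@sets_sub _ (borel_algebra R) _ bY).
(* By [borel_preimage], the default [\bot] is never met on measurable sets. *)
pose c Y := if pselect (borel (inclusion @^-1` Y)) is left bY then cls Y bY else \bot%O.
have cE Y (bY : borel (inclusion @^-1` Y)) : c Y = cls Y bY.
  rewrite /c; case: pselect => // bY'; congr qclass; exact: sets_val_inj.
exists c; split.
- move=> Y Z /borel_preimage bY /borel_preimage bZ.
  have bYZ : borel (inclusion @^-1` (Y `|` Z)).
    exact: (@set_algebraU _ (borel_algebra R)).
  rewrite !cE [RHS](esym (pi_join _ _ _)); congr qclass.
  exact: sets_val_inj.
- move=> Y Z /borel_preimage bY /borel_preimage bZ YZ.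
  rewrite !cE [LHS](esym (pi_meet _ _ _)); congr qclass.
  by apply: sets_val_inj => /=; rewrite -preimage_setI YZ preimage_set0.
- move=> Y mY Y0; have bY := borel_preimage mY; rewrite cE.
  apply: exists_ultrafilter_quotient => /= nY.
  have mY01 : measurable (Y `&` itv01).
    by apply: measurableI => //; exact: measurable_itv.
  have nY01 : mu.-negligible (Y `&` itv01).
    apply: negligibleS nY => x [Yx x01].
    by exists (SigSub (mem_set x01)).
  by have e0 := measure_negligible mY01 nY01; rewrite e0 ltxx in Y0.
Qed.

Lemma fine_chains_lebesgue (mI : measurable itv01) : fine_chains (mrestr mu mI).
Proof.
move=> delta delta0.
pose M := (Num.truncn delta^-1).+1.
have M0 : 0 < M%:R :> R by rewrite ltr0n.
have Md : M%:R^-1 < delta.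
  by rewrite -[ltRHS]invrK ltf_pV2 ?posrE ?invr_gt0// truncnS_gt.
(* Cuts are made at the multiples of [1 / M]. The ray for [k = M] stops short of the point 1, so the
   whole line is reached only at index [M.+1]. *)
pose J (k : nat) : set R :=
  if k == 0%N then set0 else if (M < k)%N then setT else `]-oo, k%:R / M%:R[%classic.
have mJ k : measurable (J k : set T) by rewrite /J; do 2 case: ifP => // _.
have I01 (x : R) : itv01 x -> 0 <= x <= 1.
  by rewrite /= in_itv.
have JP k (x : R) : itv01 x -> ~ J k x -> k%:R / M%:R <= x.
  rewrite /J => /I01/andP[x0 _].
  case: ifP => [/eqP->|_]; first by rewrite mul0r.
  by case: ifP => [_ /(_ I)//|_]; rewrite /= in_itv/= => /negP; rewrite -leNgt.
have JQ k (x : R) : itv01 x -> J k x -> x <= k%:R / M%:R.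
  rewrite /J => /I01/andP[_ x1].
  case: ifP => // _; case: ifP => [Mk _|_]; last by rewrite /= in_itv/= => /ltW.
  by apply: (le_trans x1); rewrite ler_pdivlMr// mul1r ler_nat ltnW.
exists M.+1, J; split => //.
- by rewrite /J ltnSn.
- move=> k x; rewrite /J /=; case: ifP => // k0.
  case: ifP => [Mk _|_]; first by rewrite (ltn_trans Mk).
  case: ifP => // _; rewrite /= !in_itv/= => /lt_le_trans; apply.
  by rewrite ler_pM2r ?invr_gt0// ler_nat.
- move=> k; rewrite /mrestr.
  apply: (@le_lt_trans _ _ (mu `[k%:R / M%:R, k.+1%:R / M%:R]%classic)).
    apply: le_measure; rewrite ?inE.
    + by apply: measurableI => //; exact: measurableD.
    + exact: measurable_itv.
    + move=> x [[Jx nJx] x01]; rewrite /= in_itv/=; apply/andP.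
      by split; [exact: JP|exact: JQ].
  rewrite lebesgue_measure_itv/= lte_fin ltr_pM2r ?invr_gt0// ltr_nat ltnSn.
  by rewrite -EFinB lte_fin -mulrBl -natrB// subSnn mul1r.
Qed.

End unit_interval_classes.

(** * Transfer of the functionals to the measurable sets of the line *)

Theorem theorem5p3 (R : realType) (A : set_algebra nat)
    (A_finite : forall F : set nat, finite_set F -> A F)
    (A_remainder : homeomorphic
       (set_type (remainder (principal_point A))) (stone (measure_algebra R))) :
  compactification (principal_point A) /\ ~ smooth R (principal_point A).
Proof.
split; first exact: compactification_principal_point.
move=> /(smooth_functionals A_finite)[nu [nuD nuM nu_lim]].
have [f [g [cf _ _ gK]]] := A_remainder.
have [c [cU cI c0]] := exists_preimage_class R.
have mI : measurable (`[0 : R, 1]%classic : set (measurableTypeR R)).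
  exact: measurable_itv.
(* The choice of [a] respects Boolean operations only on the remainder, which is all that [nuD] asks
   for. *)
have /choice[a aP] (Y : set (measurableTypeR R)) := continuous_stone_representative
  (c Y) (closed_remainder A_finite) cf.
have traceE Y x (rx : remainder (principal_point A) x) :
    x (a Y) <-> f (SigSub (mem_set rx)) (c Y).
  exact: (aP Y (SigSub (mem_set rx))).
have disj Y Z (x : stone (algebra_sort A)) : measurable Y -> measurable Z ->
    Y `&` Z = set0 -> remainder (principal_point A) x -> ~ (x (a Y) /\ x (a Z)).
  move=> mY mZ YZ rx [/(traceE _ _ rx) xY /(traceE _ _ rx) xZ].
  have := ultra_meet (stoneP _) xY xZ; rewrite cI//; exact: ultra_bot (stoneP _).
apply: (@no_two_valued_limit _ (measurableTypeR R) R (mrestr lebesgue_measure mI)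
  (fun n Y => nu n (a Y))).
- exact: fine_chains_lebesgue.
- by rewrite /= /mrestr setTI lebesgue_measure_itv/= lte_fin ltr01 sube0 lte_fin ltr01.
- move=> n Y Z mY mZ YZ; apply: nuD => x rx; split; first exact: disj.
  rewrite !(traceE _ _ rx) cU//.
  rewrite -[X in X <-> _]/(stone_basic (c Y `|` c Z)%O _) stone_basic_join.
  by split.
- by move=> n; have [M MP] := nuM n; exists M.
- have eighth : 0 < 1/8 :> R by rewrite divr_gt0.
  move=> Y mY; have [N NP] := nu_lim (a Y) _ eighth; exists N => n /NP.
  by rewrite indicE; case: (n \in _); rewrite ?subr0 => h; [right|left].
(* An ultrafilter containing the class of [G] gives a point of the remainder containing [a G] but
   not [a F]. Its members are infinite, so some late [n] lies in [a G] and outside [a F]. *)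
- move=> F G N mF mG FG G0; have [s sG] := c0 G mG G0.
  have eighth : 0 < 1/8 :> R by rewrite divr_gt0.
  have rx : remainder (principal_point A) (set_val (g s)) by exact: set_mem (valP (g s)).
  have xG : (set_val (g s) : stone _) (a G) by apply/aP; rewrite gK.
  have nxF : ~ (set_val (g s) : stone _) (a F).
    by move=> xF; apply: (disj F G _ mF mG FG rx).
  have xGF : (set_val (g s) : stone _) (a G `&` ~` a F)%O.
    apply: (ultra_meet (stoneP (set_val (g s))) xG).
    by case: (ultra_compl (stoneP (set_val (g s))) (a F)).
  have [NF NFP] := nu_lim (a F) _ eighth.
  have [NG NGP] := nu_lim (a G) _ eighth.
  have [n] := remainder_infinite A_finite (maxn N (maxn NF NG)) rx xGF.
  rewrite !geq_max => /and3P[Nn /NFP nF /NGP nG] [/= Gn Fn].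
  exists n => //; move: nF nG; rewrite !indicE memNset// mem_set//.
  by rewrite subr0.
Qed.
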